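(* Let $n\ge 2$ and let $P(z)=a_1z+\dots+a_nz^n$ with $a_k\in\mathbb{R}$ for $1\le k\le n$, $a_1>0$ and $a_n\neq 0$. Let $\zeta_1,\dots,\zeta_{n-1}\in\mathbb{C}$ be all zeros of the derivative $P'(z)$, counted with multiplicity. Then $$J(P)=2a_1^{\frac{n(n-1)}{2}}(na_n)^n\prod_{1\le i\le j\le n-1}(\zeta_i\zeta_j-1)=2a_1^{\frac{n(n-1)}{2}}(na_n)^{n-2}\,P'(1)\,P'(-1)\prod_{1\le i<j\le n-1}(\zeta_i\zeta_j-1).$$
   Context: Let $\mathbb{D}$ be the open unit disk in $\mathbb{C}$. For a polynomial $P(z)=a_1z+\dots+a_nz^n$ and an integer $k\ge0$, the complex moment is $$M_k(P)=\frac{i}{2\pi}\iint_{\mathbb{D}}P(z)^k|P'(z)|^2\,dz\wedge d\overline{z}=\frac1\pi\iint_{\mathbb{D}}P(z)^k|P'(z)|^2\,dx\,dy .$$ For real coefficients, $M_k(P)$ is a real polynomial function of $(a_1,\dots,a_n)$. The moment mapping is $\mu(P)=(M_0(P),\dots,M_{n-1}(P))$, regarded as a function of $(a_1,\dots,a_n)$, and its Jacobian is $$J(P)=\det d\mu(P)=\det\left[\frac{\partial M_k(P)}{\partial a_\nu}\right]_{0\le k\le n-1,\ 1\le\nu\le n}.$$ Empty products equal $1$. *)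

(* Defs.v *)
From HB Require Import structures.
From mathcomp Require Import all_boot all_order all_algebra.
From mathcomp Require Import complex.
From mathcomp Require Import all_classical all_reals all_analysis.
Set Implicit Arguments.
Unset Strict Implicit.
Unset Printing Implicit Defensive.
Import Order.TTheory GRing.Theory Num.Theory.
Import numFieldNormedType.Exports.

Local Open Scope classical_set_scope.
Local Open Scope ring_scope.
Local Open Scope complex_scope.

(* Coefficients are numbered from 0 in the vector: a 0 i is the coefficient
   of X^(i+1), so there is no constant term. *)
Definition poly_of_coefs (R : realType) (n : nat) (a : 'rV[R]_n) : {poly R} :=
  \sum_(i < n) a 0 i *: 'X^(i.+1).

Definition complex_poly (R : realType) (p : {poly R}) : {poly R[i]} :=
  map_poly (real_complex R) p.

(* The point (x, y) of R * R stands for x + i y. *)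
Definition unit_disk (R : realType) : set (R * R) :=
  [set z | `|z.1 +i* z.2| < 1].

(* Integral with respect to dx dy of a complex-valued function. *)
Definition disk_integral (R : realType) (f : R[i] -> R[i]) : R[i] :=
  let mu := (@lebesgue_measure R \x @lebesgue_measure R)%E in
  (\int[mu]_(z in @unit_disk R) complex.Re (f (z.1 +i* z.2)))
  +i* (\int[mu]_(z in @unit_disk R) complex.Im (f (z.1 +i* z.2))).

Definition moment (R : realType) (k : nat) (P : {poly R[i]}) : R[i] :=
  (pi%:C)^-1 * disk_integral (fun z => P.[z] ^+ k * `|P^`().[z]| ^+ 2).

(* The moments are complex numbers by definition, even for real coefficients:
   real and imaginary parts are differentiated separately. *)
Definition partial (R : realType) (n : nat) (f : 'rV[R]_n -> R[i])
    (nu : 'I_n) (a : 'rV[R]_n) : R[i] :=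
  ('D_(delta_mx 0 nu) (fun b : 'rV[R]_n => complex.Re (f b)) a)
  +i* ('D_(delta_mx 0 nu) (fun b : 'rV[R]_n => complex.Im (f b)) a).

Definition moment_jacobian (R : realType) (n : nat) (a : 'rV[R]_n) : R[i] :=
  \det (\matrix_(k < n, nu < n)
          partial (fun b => moment k (complex_poly (poly_of_coefs b))) nu a).

(* Main.v *)
Require Import Defs.
From HB Require Import structures.
From mathcomp Require Import all_boot all_order all_algebra.
From mathcomp Require Import complex.
From mathcomp Require Import all_classical all_reals all_analysis.
From mathcomp Require Import measurable_realfun.
From mathcomp Require Import ring lra zify.
Import Order.TTheory GRing.Theory Num.Theory.
Import numFieldNormedType.Exports.
Local Open Scope ring_scope.
Local Open Scope complex_scope.

(** The integrals of [z^p zbar^q] over the disk vanish for [p <> q] and equal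
    [pi / (p + 1)] for [p = q] (lemma [disk_integral_monomial]).  Hence, for
    [P = a_1 z + ... + a_n z^n] with real coefficients, [M_k(P)] is the sum over
    [i] of [a_(i+1)] times the coefficient of [z^i] in [P^k P'] (lemma [momentE]).
    These integrals are computed without polar coordinates.  Fubini and the
    fundamental theorem of calculus along chords show that both partial
    derivatives of [z^p zbar^q (1 - z zbar)] integrate to 0 over the disk, since
    that function vanishes on the unit circle.  Combined into the Wirtinger
    derivative in [z], this is a recursion between the integrals
    (lemma [disk_monomial_rec]); it reduces all of them to the area of the disk.

    Write [p_i] for the coefficients of [P'].  As
    [P^k P' = (P^(k+1))' / (k + 1)], differentiating gives
      [dM_k / da_(j+1) = sum_m [z^m](P^k) * (p_(j+m) + p_(j-m))]
    (lemma [is_derive_moment_sum]).  So the Jacobian matrix is a product [T C^t],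
    where [T] is the matrix of coefficients of the powers [P^k] and [C] is the
    Toeplitz-plus-Hankel matrix with entries [p_(j+m) + p_(j-m)].  The matrix [T]
    is triangular with diagonal [1, a_1, a_1^2, ...], because [P] has no constant
    term; this produces the power of [a_1] (lemma [moment_jacobianE]).

    There remains the determinant of [C] (lemma [det_sym_toeplitz]).  Row [j] of
    [C] lists the coefficients of the reciprocal Laurent polynomial
      [S_p(x^j) = p(x) x^(-j) + p(1/x) x^j].
    If [p = (x - zeta) q], then
    [S_p((x - zeta) f) = (x - zeta)(1/x - zeta) S_q(f)], and [S_p(1)] takes the
    value [p(1/zeta)] at [zeta].  Replacing the rows [x^(j+1)] by
    [(x - zeta) x^j] and one column by evaluation at [zeta] therefore peels off
    one zero and leaves the matrix of [q] (lemma [det_sym_toeplitz_mulXsubC]).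
    By induction on the number of zeros the product of the
    [zeta_i zeta_j - 1] over [i <= j] appears.  Separating the factors with
    [i = j] as [(1 - zeta_i)(-1 - zeta_i)] turns them into [P'(1) P'(-1)], up to
    the leading coefficient of [P'] (lemma [prod_leq_pairs]). *)

Set Implicit Arguments.
Unset Strict Implicit.
Unset Printing Implicit Defensive.

(** * Determinants of symmetrized Toeplitz matrices *)

Lemma sum_shift (A : nzRingType) n j (f w : nat -> A) : (j < n)%N ->
  (forall k, (n <= k)%N -> f k = 0) ->
  \sum_(m < n) f (j + m)%N * w m =
  \sum_(l < n) (if (j <= l)%N then f l * w (l - j)%N else 0).
Proof.
move=> jn f0.
rewrite -!(big_mkord xpredT (fun m => f (j + m)%N * w m)) -(big_mkord xpredT
  (fun l => if (j <= l)%N then f l * w (l - j)%N else 0)).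
rewrite (big_cat_nat (n := n - j)) ?leq_subr //= [X in _ + X]big_nat.
rewrite [X in _ + X]big1 ?addr0; last first.
  by move=> m /andP[hm _]; rewrite f0 ?mul0r// -leq_subLR.
rewrite [RHS](big_cat_nat (n := j)) ?(ltnW jn)//= [X in X + _]big_nat.
rewrite [X in X + _]big1 ?add0r; last first.
  by move=> m /andP[_ hm]; rewrite leqNgt hm.
rewrite -[X in _ = \sum_(X <= _ < _) _]add0n big_addn; apply: eq_bigr => m _.
by rewrite leq_addl addnK addnC.
Qed.

Section SymmetrizedToeplitz.
Variable K : fieldType.
Implicit Types (p q : {poly K}) (z : K).

(** The coefficient of [x^m] in the reciprocal Laurent polynomial
    [p(x) x^(-j) + p(1/x) x^j]; the one of [x^(-m)] is the same.  For [m = 0] the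
    two halves coincide and the constant term is [2 p_j]. *)
Definition sym_entry p (j m : nat) : K :=
  p`_(j + m) + (if (m <= j)%N then p`_(j - m) else 0).

Definition sym_toeplitz n p : 'M[K]_n := \matrix_(j, m) sym_entry p j m.

(** The value at [z] of the [m]-th vector of the basis
    [1, x + 1/x, x^2 + 1/x^2, ...] of the reciprocal Laurent polynomials, on which
    the [sym_entry p j m] are coordinates. *)
Definition recip_basis z (m : nat) : K := if m == 0%N then 1 else z ^+ m + z ^- m.

(** Evaluation at [z] of the Laurent polynomial whose coordinates form row [j].
    On both sides the coefficient [p_l] is multiplied by
    [z^(l-j) + z^(j-l)]. *)
Lemma sum_sym_entry n p z (j : nat) : z != 0 -> (size p <= n)%N -> (j < n)%N ->
  \sum_(m < n) sym_entry p j m * recip_basis z m =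
  p.[z^-1] * z ^+ j + p.[z] * z ^- j.
Proof.
move=> z0 sp jn; pose w := recip_basis z.
have up : \sum_(m < n) p`_(j + m) * w m =
    \sum_(l < n) (if (j <= l)%N then p`_l * w (l - j)%N else 0).
  by apply: sum_shift => // k nk; rewrite nth_default// (leq_trans sp).
have down : \sum_(m < n) (if (m <= j)%N then p`_(j - m) else 0) * w m =
    \sum_(l < n) (if (l <= j)%N then p`_l * w (j - l)%N else 0).
  rewrite -(big_mkord xpredT (fun m => (if (m <= j)%N then p`_(j - m) else 0) * w m)).
  rewrite -(big_mkord xpredT (fun l => if (l <= j)%N then p`_l * w (j - l)%N else 0)).
  rewrite (big_cat_nat (n := j.+1)) //= [X in _ + X]big_nat.
  rewrite [X in _ + X]big1 ?addr0; last first.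
    by move=> m /andP[hm _]; rewrite leqNgt hm mul0r.
  rewrite [RHS](big_cat_nat (n := j.+1)) //= [X in _ + X]big_nat.
  rewrite [X in _ + X]big1 ?addr0; last first.
    by move=> m /andP[hm _]; rewrite leqNgt hm.
  rewrite big_nat_rev /= !big_nat; apply: eq_bigr => m /andP[_ hm].
  rewrite add0n subSS leq_subr -ltnS hm.
  by rewrite subKn.
transitivity (\sum_(l < n) p`_l * (z ^+ j * z ^- l + z ^+ l * z ^- j)); last first.
  rewrite !(horner_coef_wide _ sp) !mulr_suml -big_split /=; apply: eq_bigr => l _.
  by rewrite -exprVn; ring.
under eq_bigr do rewrite mulrDl.
rewrite big_split /= up down -big_split /=; apply: eq_bigr => l _.
have zj k : z ^+ k != 0 by rewrite expf_neq0.
have e (a b : nat) : (a < b)%N -> w (b - a)%N = z ^+ b * z ^- a + z ^+ a * z ^- b.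
  move=> ab; rewrite /w /recip_basis subn_eq0 leqNgt ab /= expfB // .
  by rewrite invf_div.
have [lj|lj|->] := ltngtP l j.
- by rewrite add0r e.
- by rewrite addr0 e// addrC.
- by rewrite subnn /w /recip_basis /= divff//; ring.
Qed.

(** With [S_p(f) = p(x) f(1/x) + p(1/x) f(x)], the identity
    [S_p((x - z) f) = (x - z)(1/x - z) S_q(f)] at [f = x^i], read off on the
    coefficient of [x^(m+1)]: the factor [(x - z)(1/x - z)] is
    [(1 + z^2) - z (x + 1/x)]. *)
Lemma sym_entry_mulXsubC q z (i m : nat) :
  let p := ('X - z%:P) * q in
  sym_entry p i.+1 m.+1 - z * sym_entry p i m.+1 =
  (1 + z ^+ 2) * sym_entry q i m.+1 - z * (sym_entry q i m + sym_entry q i m.+2).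
Proof.
move=> p; rewrite /sym_entry.
have pS k : p`_k.+1 = q`_k - z * q`_k.+1.
  by rewrite /p mulrBl coefB coefXM mulrC coefMC mulrC.
have p0 : p`_0 = - z * q`_0.
  by rewrite /p mulrBl coefB coefXM mul_polyC coefZ /=; ring.
rewrite ltnS subSS !addSn !addnS !pS.
have [im|im|im] := ltngtP m i.
- case: (ltngtP m.+1 i) im => [mi _|//|<- _].
  + have -> : (i - m)%N = (i - m.+2).+2 by lia.
    have -> : (i - m.+1)%N = (i - m.+2).+1 by lia.
    by rewrite !pS; ring.
  + by rewrite subnn p0 subSnn !pS; ring.
- have -> : (m.+1 < i)%N = false by lia.
  by ring.
- have -> : (m.+1 < i)%N = false by lia.
  by rewrite im subnn p0; ring.
Qed.

(** The rows are changed from the basis [x^j] to the basis [1, (x - z) x^j]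
    (matrix [U]) and the first column is replaced by evaluation at [z]
    (matrix [W]).  Every row but the first then is a multiple of [x - z], hence
    vanishes in that column, while the first entry is [S_p(1)(z) = p(1/z)].  The
    remaining minor is the matrix of [q] times that of multiplication by
    [(1 + z^2) - z (x + 1/x)] (matrix [L]), which is triangular with diagonal
    [- z]. *)
Lemma det_sym_toeplitz_mulXsubC N q z : z != 0 -> (size q <= N.+1)%N ->
  let p := ('X - z%:P) * q in
  \det (sym_toeplitz N.+2 p) =
  p.[z^-1] * (- z) ^+ N.+1 * \det (sym_toeplitz N.+1 q).
Proof.
move=> z0 sq p; set C := sym_toeplitz _ p.
have sp : (size p <= N.+2)%N.
  have [q0|q0] := eqVneq q 0; first by rewrite /p q0 mulr0 size_poly0.
  by rewrite /p mulrC size_Mmonic ?monicXsubC// size_XsubC addnC.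
have pz : p.[z] = 0 by rewrite /p !hornerE subrr mul0r.
pose U : 'M[K]_N.+2 := \matrix_(i, k) ((i == k)%:R - z * (i == k.+1 :> nat)%:R).
pose W : 'M[K]_N.+2 := \matrix_(k, m)
  (if m == 0 then recip_basis z k else (k == m)%:R).
have detU : \det U = 1.
  rewrite det_trig; last first.
    apply/is_trig_mxP => i k ik; rewrite mxE.
    have -> : (i == k) = false by apply/negbTE/eqP=> e; rewrite e ltnn in ik.
    by rewrite (_ : (i == k.+1 :> nat) = false) ?mulr0 ?subr0//; lia.
  rewrite big1// => i _; rewrite mxE eqxx (_ : (i == i.+1 :> nat) = false); last lia.
  by rewrite mulr0 subr0.
have detW : \det W = 1.
  rewrite det_trig; last first.
    apply/is_trig_mxP => k m km; rewrite mxE.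
    have -> : (m == 0) = false by apply/negbTE/eqP=> e; rewrite e ltn0 in km.
    by have -> : (k == m) = false by apply/negbTE/eqP=> e; rewrite e ltnn in km.
  rewrite big1// => i _; rewrite mxE; case: eqP => [->|_]; last by rewrite eqxx.
  by rewrite /recip_basis.
have CW j m : (C *m W) j m =
    if m == 0 then p.[z^-1] * z ^+ j else sym_entry p j m.
  rewrite mxE; under eq_bigr do rewrite !mxE.
  have [_|m0] := eqVneq m 0.
    by rewrite (sum_sym_entry z0 sp (ltn_ord j)) pz mul0r addr0.
  rewrite (bigD1 m)//= eqxx mulr1 big1 ?addr0// => k /negbTE km.
  by rewrite km mulr0.
have UCW0 m : (U *m (C *m W)) 0 m = (C *m W) 0 m.
  rewrite mxE (bigD1 0)//= big1; last first.
    by move=> k k0; rewrite mxE eq_sym (negbTE k0) mulr0 subr0 mul0r.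
  by rewrite addr0 mxE eqxx mulr0 subr0 mul1r.
have UCWS (i : 'I_N.+1) m : (U *m (C *m W)) (lift 0 i) m =
    (C *m W) (lift 0 i) m - z * (C *m W) (widen_ord (leqnSn _) i) m.
  rewrite mxE; under eq_bigr do rewrite mxE mulrBl.
  rewrite sumrB (bigD1 (lift 0 i))//= eqxx mul1r big1 ?addr0; last first.
    by move=> k kl; rewrite eq_sym (negbTE kl) mul0r.
  congr (_ - _); rewrite (bigD1 (widen_ord (leqnSn _) i))//= /bump /= add1n eqxx mulr1.
  rewrite big1 ?addr0// => k kl; rewrite (_ : (i.+1 == k.+1) = false) ?mulr0 ?mul0r//.
  by apply: contraNF kl => /eqP[e]; apply/eqP/val_inj.
have -> : \det C = \det (U *m (C *m W)) by rewrite !det_mulmx detU detW mul1r mulr1.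
rewrite (expand_det_col _ 0) (bigD1 0)//= big1 ?addr0; last first.
  move=> i i0; case: (unliftP 0 i) i0 => [k ->|->]; last by rewrite eqxx.
  move=> _; rewrite UCWS !CW !eqxx /= /bump /= add1n exprS.
  by rewrite (_ : _ - _ = 0) ?mul0r//; ring.
rewrite UCW0 CW eqxx expr0 mulr1 -mulrA; congr (_ * _).
rewrite /cofactor expr0 mul1r.
pose L : 'M[K]_N.+1 := \matrix_(k, m) ((1 + z ^+ 2) * (k == m.+1 :> nat)%:R
   - z * ((k == m)%:R + (k == m.+2 :> nat)%:R)).
have detL : \det L = (- z) ^+ N.+1.
  rewrite det_trig; last first.
    apply/is_trig_mxP => k m km; rewrite mxE.
    have -> : (k == m) = false by apply/negbTE/eqP=> e; rewrite e ltnn in km.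
    have -> : (k == m.+1 :> nat) = false by lia.
    have -> : (k == m.+2 :> nat) = false by lia.
    by rewrite addr0 !mulr0 subr0.
  under eq_bigr => i _.
    rewrite mxE eqxx (_ : (i == i.+1 :> nat) = false); last lia.
    rewrite (_ : (i == i.+2 :> nat) = false); last lia.
    rewrite mulr0 sub0r addr0 mulr1; over.
  by rewrite prodr_const card_ord.
rewrite -detL mulrC -det_mulmx; congr (\det _).
apply/matrixP => i m; rewrite [LHS]mxE [LHS]mxE UCWS !CW /=.
rewrite /bump /= !add1n sym_entry_mulXsubC.
(* The columns 0, ..., N of L involve the coefficients of x^m, x^(m+1) and
   x^(m+2) in row i of the matrix of q; those of index beyond N are 0. *)
have sum_at (k : nat) (F : nat -> K) : ((N.+1 <= k)%N -> F k = 0) ->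
    \sum_(l < N.+1) F l * (l == k :> nat)%:R = F k.
  move=> Fk; case: (ltnP k N.+1) => [kn|/Fk Fk0].
    rewrite (bigD1 (Ordinal kn))//= eqxx mulr1 big1 ?addr0// => l lk.
    rewrite (_ : (l == k :> nat) = false) ?mulr0//.
    by apply: contraNF lk => /eqP e; apply/eqP/val_inj.
  rewrite Fk0 big1// => l _; case: eqP => [->|]; last by rewrite mulr0.
  by rewrite Fk0 mul0r.
have out k : (N.+1 <= k)%N -> sym_entry q i k = 0.
  move=> Nk; rewrite /sym_entry nth_default ?add0r; last first.
    by rewrite (leq_trans sq)// (leq_trans Nk)// leq_addl.
  by rewrite leqNgt (leq_trans (ltn_ord i) Nk).
rewrite mxE; under eq_bigr do rewrite !mxE.
rewrite -(sum_at m.+1 _ (@out _)) -{1}(sum_at m _ (@out _)) -(sum_at m.+2 _ (@out _)).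
rewrite -big_split /= !mulr_sumr -sumrB; apply: eq_bigr => l _.
by rewrite -val_eqE /=; ring.
Qed.

(** Peeling off the first zero [z_0] of [p = (x - z_0) q] contributes
    [p(1/z_0) (- z_0)^n], and each factor [1/z_0 - z_j] of [p(1/z_0)], multiplied
    by [- z_0], becomes [z_0 z_j - 1]. *)
Lemma det_sym_toeplitz n (c : K) (z : 'I_n -> K) : (forall i, z i != 0) ->
  \det (sym_toeplitz n.+1 (c *: \prod_(i < n) ('X - (z i)%:P))) =
  2 * c ^+ n.+1 * \prod_(i < n) \prod_(j < n | (i <= j)%N) (z i * z j - 1).
Proof.
elim: n z => [|n IHn] z z0.
  rewrite !big_ord0 (mx11_scalar (sym_toeplitz _ _)) det_scalar1 mxE.
  rewrite /sym_entry /= coefZ coef1 /=; ring.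
rewrite big_ord_recl scalerAr; set q := c *: _.
have sq : (size q <= n.+1)%N.
  apply: leq_trans (size_scale_leq _ _) _.
  rewrite size_prod_XsubC ltnS -[X in (_ <= X)%N](size_enum_ord n).
  by rewrite -[index_enum _]enumT.
rewrite det_sym_toeplitz_mulXsubC// IHn; last by move=> i; exact: z0.
rewrite big_ord_recl big_mkcond big_ord_recl /=.
have -> : \prod_(i < n) \prod_(j < n.+1 | (bump 0 i <= j)%N)
      (z (lift ord0 i) * z j - 1)
   = \prod_(i < n) \prod_(j < n | (i <= j)%N)
      (z (lift ord0 i) * z (lift ord0 j) - 1).
  apply: eq_bigr => i _; rewrite big_mkcond big_ord_recl /= mul1r -big_mkcond /=.
  by apply: eq_bigl => j; rewrite /bump !add1n ltnS.
rewrite hornerM hornerZ horner_prod; set D := \prod_(i < n) \prod_(_ < _ | _) _.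
have -> : \prod_(i < n) (z ord0 * z (lift ord0 i) - 1) =
   (- z ord0) ^+ n * \prod_(i < n) ('X - (z (lift ord0 i))%:P).[(z ord0)^-1].
  rewrite -[n in (- _) ^+ n](card_ord n) -prodr_const -big_split /=.
  apply: eq_bigr => i _; rewrite !hornerE /=; field; exact: z0.
set E := \prod_(i < n) _.
rewrite hornerXsubC !(exprS c) (exprS (- z ord0)) /=.
set F := (- z ord0) ^+ n; set G := c ^+ n.
by field; exact: z0.
Qed.

End SymmetrizedToeplitz.

(** * Differentiating moment sums of real polynomials *)

Section MomentSumDerivative.
Variable R : realType.
Implicit Types P Q : {poly R}.

Lemma derive_along (V : normedModType R) (f : V -> R) (a v : V) (d : R) :
  is_derive (0 : R) 1 (fun h : R => f (h *: v + a)) d -> 'D_v f a = d.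
Proof.
case=> _ <-; rewrite /derive.
apply: (congr1 (fun F : R -> R => lim (F @ 0^')%classic)).
apply/funext => h /=.
by rewrite scale0r add0r addr0 /GRing.scale /= mulr1.
Qed.

Lemma is_derive_affine (b c : R) : is_derive (0 : R) 1 (fun h : R => b + h * c) c.
Proof.
have -> : (fun h : R => b + h * c) = cst b + c \*: id.
  by apply/funext => h; rewrite /= /GRing.scale /= mulrC.
apply: is_derive_eq.
by rewrite add0r /GRing.scale /= mulr1.
Qed.

Lemma is_derive_coef_expDZ P Q (m i : nat) :
  is_derive (0 : R) 1 (fun h : R => ((P + h *: Q) ^+ m)`_i)
    ((P ^+ m.-1 * Q)`_i *+ m).
Proof.
elim: m i => [|m IHm] i.
  by rewrite mulr0n; under eq_fun do rewrite expr0; exact: is_derive_cst.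
under eq_fun do rewrite exprS coefM.
have -> : (fun h : R => \sum_(j < i.+1)
     (P + h *: Q)`_j * ((P + h *: Q) ^+ m)`_(i - j)) =
   \sum_(j < i.+1) ((fun h => P`_j + h * Q`_j) *
     (fun h => ((P + h *: Q) ^+ m)`_(i - j))).
  apply/funext => h; rewrite fct_sumE; apply: eq_bigr => j _.
  by rewrite coefD coefZ.
have D (j : 'I_i.+1) := is_deriveM (is_derive_affine P`_j Q`_j) (IHm (i - j)%N).
apply: (is_derive_eq (is_derive_sum D)).
rewrite scale0r addr0 /= big_split /=.
transitivity ((P * (P ^+ m.-1 * Q *+ m))`_i + (Q * P ^+ m)`_i).
  rewrite !coefM; congr (_ + _); apply: eq_bigr => j _.
    by rewrite mul0r addr0 coefMn.
  by rewrite mulrC.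
rewrite -coefD -coefMn; congr (_`_i).
case: m {IHm D} => [|m] /=; first by rewrite mulr0n mulr0 add0r mulr1n mulrC.
by rewrite mulrnAr mulrA -exprS [Q * _]mulrC -mulrSr.
Qed.

Lemma coef_expM_deriv P k i :
  (P ^+ k * P^`())`_i = i.+1%:R / k.+1%:R * (P ^+ k.+1)`_i.+1.
Proof.
have /(congr1 (fun q : {poly R} => q`_i)) := deriv_exp P k.+1.
rewrite coef_deriv coefMn /= mulrC => e.
have k0 : k.+1%:R != 0 :> R by rewrite pnatr_eq0.
apply: (mulfI k0); rewrite [LHS]mulr_natl -e -mulr_natl.
by field.
Qed.

(** The value of the [k]-th moment of a polynomial with real coefficients, no
    constant term and degree at most [n]. *)
Definition real_moment n k P : R :=
  \sum_(i < n) (P ^+ k * P^`())`_i * P`_i.+1.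

(** Product rule in [real_moment]: by [coef_expM_deriv] each summand is
    [i + 1] over [k + 1] times a coefficient of [P^(k+1)] times a coefficient of
    [P].  Differentiating the first factor gives the products
    [[z^m](P^k) p_(nu+m)], the second one gives the [nu]-th coefficient of
    [P^k P'], which is the sum of the [[z^m](P^k) p_(nu-m)]. *)
Lemma is_derive_moment_sum n (nu : 'I_n) P k : (size P <= n.+1)%N ->
  is_derive (0 : R) 1
    (fun h : R => real_moment n k (P + h *: 'X^(nu.+1)))
    (\sum_(m < n) (P ^+ k)`_m * sym_entry P^`() nu m).
Proof.
move=> sP; set Q := 'X^_.
have -> : (fun h : R => real_moment n k (P + h *: Q)) =
  \sum_(i < n) (((i.+1%:R / k.+1%:R) \*: (fun h => ((P + h *: Q) ^+ k.+1)`_i.+1)) *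
     (fun h => P`_i.+1 + h * Q`_i.+1)).
  apply/funext => h; rewrite fct_sumE; apply: eq_bigr => i _.
  by rewrite coef_expM_deriv coefD coefZ.
have D (i : 'I_n) := is_deriveM
  (is_deriveZ (i.+1%:R / k.+1%:R) (is_derive_coef_expDZ P Q k.+1 i.+1))
  (is_derive_affine P`_i.+1 Q`_i.+1).
apply: (is_derive_eq (is_derive_sum D)).
have sP' k' : (n <= k')%N -> P^`()`_k' = 0.
  move=> nk; rewrite coef_deriv nth_default ?mul0rn//.
  by rewrite (leq_trans sP).
rewrite [RHS](_ : _ = \sum_(m < n) P^`()`_(nu + m) * (P ^+ k)`_m
    + (P ^+ k * P^`())`_nu); last first.
  under eq_bigr do rewrite mulrDr; rewrite big_split /=; congr (_ + _).
    by apply: eq_bigr => m _; rewrite mulrC.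
  rewrite coefM (big_ord_widen n (fun j => (P ^+ k)`_j * P^`()`_(nu - j)))//.
  rewrite [RHS]big_mkcond; apply: eq_bigr => m _; rewrite ltnS.
  by case: ifP; rewrite ?mulr0.
rewrite (sum_shift (fun j => (P ^+ k)`_j) (ltn_ord nu) sP').
rewrite [X in _ = _ + X](_ : _ =
  \sum_(i < n) (P ^+ k * P^`())`_i * (i == nu)%:R); last first.
  rewrite (bigD1 nu)//= eqxx mulr1 big1 ?addr0// => i /negbTE inu.
  by rewrite inu mulr0.
rewrite -big_split /=; apply: eq_bigr => i _.
rewrite /= mul0r addr0 scale0r addr0 /GRing.scale /= -coef_expM_deriv.
rewrite [LHS]addrC; congr (_ + _); last first.
  by rewrite coefXn eqSS.
(* shifting by X^(nu+1) and differentiating once leaves a shift by nu *)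
rewrite coef_deriv /Q exprSr mulrA coefMX /= coefMXn /GRing.scale /=.
rewrite ltnNge; case: leqP => _ /=; last by rewrite ?mul0rn ?mulr0.
rewrite -mulr_natl -[P`_i.+1 *+ _]mulr_natl.
by field.
Qed.

End MomentSumDerivative.

(** * Integration over the unit disk *)

Section DiskSlices.
Variable R : realType.
Local Open Scope classical_set_scope.
Local Notation mu1 := (@lebesgue_measure R).
Local Notation mu2 := ((@lebesgue_measure R \x @lebesgue_measure R)%E).
Local Notation D := (@unit_disk R).

Lemma unit_diskE (x y : R) : D (x, y) <-> x ^+ 2 + y ^+ 2 < 1.
Proof.
rewrite /unit_disk /= normc_def /= -[1%R]/(1%:C) ltcR.
by rewrite -[X in _ < X]sqrtr1 ltr_sqrt.
Qed.

Definition half_chord (x : R) : R := Num.sqrt (1 - x ^+ 2).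

Lemma sqr_half_chord x : `|x| < 1 -> half_chord x ^+ 2 = 1 - x ^+ 2.
Proof.
move=> x1; rewrite sqr_sqrtr// subr_ge0 -real_normK ?num_real//.
by rewrite expr_le1// ltW.
Qed.

Lemma half_chord_gt0 x : `|x| < 1 -> 0 < half_chord x.
Proof.
move=> x1; rewrite sqrtr_gt0 subr_gt0 -real_normK ?num_real//.
by rewrite expr_lt1.
Qed.

Lemma disk_slice (x : R) : [set y | x ^+ 2 + y ^+ 2 < 1] =
  if `|x| < 1 then `](- half_chord x), (half_chord x)[%classic else set0.
Proof.
apply/seteqP; split=> y /=.
  move=> xy; have x1 : `|x| < 1.
    rewrite -(@expr_lt1 _ 2)// real_normK ?num_real//.
    by rewrite (le_lt_trans _ xy)// lerDl sqr_ge0.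
  rewrite x1 /= ?in_itv /= -ltr_norml -(@ltr_pXn2r _ 2)// ?nnegrE ?sqrtr_ge0//.
  by rewrite sqr_half_chord// real_normK ?num_real// ltrBrDl.
case: ifP => // x1 /=.
rewrite in_itv /= -ltr_norml -(@ltr_pXn2r _ 2)// ?nnegrE ?sqrtr_ge0//.
by rewrite sqr_half_chord// real_normK ?num_real// ltrBrDl.
Qed.

Lemma measurable_unit_disk : measurable D.
Proof.
have -> : D = [set: R * R] `&` (fun z => z.1 ^+ 2 + z.2 ^+ 2) @^-1` `]-oo, 1[.
  by apply/seteqP; split=> [] [x y]; rewrite /= ?in_itv /=;
    [move/unit_diskE|move=> [_ /unit_diskE]].
have : measurable_fun [set: R * R] (fun z => z.1 ^+ 2 + z.2 ^+ 2).
  by apply: measurable_funD; apply: measurable_funX;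
    [exact: measurable_fst|exact: measurable_snd].
by apply.
Qed.

Lemma unit_disk_finite : (mu2 D < +oo)%E.
Proof.
apply: (@le_lt_trans _ _ (mu2 (`[-1, 1] `*` `[-1, 1]))).
  apply: le_measure; rewrite ?inE.
  - exact: measurable_unit_disk.
  - exact: measurableX.
  - move=> [x y] /unit_diskE xy; split; rewrite /= in_itv /= -ler_norml;
      rewrite -(@expr_le1 _ 2)// real_normK ?num_real// (le_trans _ (ltW xy))//.
      by rewrite lerDl sqr_ge0.
    by rewrite lerDr sqr_ge0.
rewrite product_measure1E//= lebesgue_measure_itv /= lte_fin ifT.
  by rewrite -EFinB -EFinM ltry.
by rewrite (@lt_trans _ _ 0).
Qed.

(** A class of functions that is easily seen to be closed under ring operations
    and whose members are integrable over the disk. *)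
Definition disk_bounded (f : R * R -> R) :=
  measurable_fun setT f /\ exists M, forall z, D z -> `|f z| <= M.

Lemma disk_bounded_integrable f : disk_bounded f -> mu2.-integrable D (EFin \o f).
Proof.
move=> [mf [M fM]]; apply: measurable_bounded_integrable.
- exact: measurable_unit_disk.
- exact: unit_disk_finite.
- exact: measurable_funTS.
- exists M; split; first exact: num_real.
  by move=> N MN z Dz; exact: le_trans (fM z Dz) (ltW MN).
Qed.

Lemma Fubini_disk_xy f : disk_bounded f ->
  (\int[mu2]_(z in D) (f z)%:E =
   \int[mu1]_(x in `](-1)%R, 1%R[)
      \int[mu1]_(y in `](- half_chord x)%R, half_chord x[) (f (x, y))%:E)%E.
Proof.
move=> /disk_bounded_integrable fi.
rewrite integral_mkcond -integral12_prod_meas1; last first.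
  by have /integrable_mkcond := fi; apply; exact: measurable_unit_disk.
rewrite [RHS]integral_mkcond; apply: eq_integral => x _.
rewrite /fubini_F [RHS]patchE mem_setE in_itv /= -ltr_norml.
transitivity (\int[mu1]_(y in [set y | (x ^+ 2 + y ^+ 2 < 1)%R]) (f (x, y))%:E)%E.
  rewrite [RHS]integral_mkcond; apply: eq_integral => y _.
  rewrite !patchE; congr (if _ then _ else _).
  by apply/idP/idP; rewrite !inE /=; move/unit_diskE.
by rewrite disk_slice; case: ifP => // _; rewrite integral_set0.
Qed.

Lemma Fubini_disk_yx f : disk_bounded f ->
  (\int[mu2]_(z in D) (f z)%:E =
   \int[mu1]_(y in `](-1)%R, 1%R[)
      \int[mu1]_(x in `](- half_chord y)%R, half_chord y[) (f (x, y))%:E)%E.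
Proof.
move=> /disk_bounded_integrable fi.
rewrite integral_mkcond -integral21_prod_meas1; last first.
  by have /integrable_mkcond := fi; apply; exact: measurable_unit_disk.
rewrite [RHS]integral_mkcond; apply: eq_integral => y _.
rewrite /fubini_G [RHS]patchE mem_setE in_itv /= -ltr_norml.
transitivity (\int[mu1]_(x in [set x | (y ^+ 2 + x ^+ 2 < 1)%R]) (f (x, y))%:E)%E.
  rewrite [RHS]integral_mkcond; apply: eq_integral => x _.
  rewrite !patchE; congr (if _ then _ else _).
  by apply/idP/idP; rewrite !inE /= addrC; move/unit_diskE.
by rewrite disk_slice; case: ifP => // _; rewrite integral_set0.
Qed.

End DiskSlices.

Section DiskIntegral.
Variable R : realType.
Implicit Types (x y : R) (F G : R[i] -> R[i]).
Local Notation mu1 := (@lebesgue_measure R).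
Local Notation mu2 := ((@lebesgue_measure R \x @lebesgue_measure R)%E).
Local Notation D := (@unit_disk R).

Lemma integral_deriv_poly (q : {poly R}) (s : R) : 0 < s ->
  (\int[mu1]_(x in `](- s)%R, s[) (q^`().[x])%:E = (q.[s] - q.[- s])%:E)%E.
Proof.
move=> s0; rewrite -(integral_itv_bndoo true false); last first.
  apply/measurable_EFinP; apply: measurable_funTS.
  by apply: continuous_measurable_fun; exact: continuous_horner.
rewrite (@continuous_FTC2 _ _ (horner q))//.
- by rewrite (lt_trans _ s0)// oppr_lt0.
- by apply: continuous_subspaceT; exact: continuous_horner.
- split.
  + by move=> x _; exact: derivable_horner.
  + by apply: cvg_at_right_filter; exact: continuous_horner.
  + by apply: cvg_at_left_filter; exact: continuous_horner.
- by move=> x _; rewrite derivE.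
Qed.

(** Taking real parts of the coefficients of a polynomial with complex
    coefficients commutes with evaluation at real points and with derivation;
    this brings the integrals of complex polynomials along chords down to the
    fundamental theorem of calculus for real polynomials. *)
Definition Re_poly (p : {poly R[i]}) : {poly R} := \poly_(i < size p) complex.Re p`_i.

Lemma coef_Re_poly p i : (Re_poly p)`_i = complex.Re p`_i.
Proof.
by rewrite coef_poly; case: ltnP => // pi; rewrite nth_default.
Qed.

Lemma Re_sum (I : Type) (r : seq I) (F : I -> R[i]) :
  complex.Re (\sum_(i <- r) F i) = \sum_(i <- r) complex.Re (F i).
Proof. by apply: (big_morph (@complex.Re R)) => // [] [a b] [c d]. Qed.

Lemma horner_Re_poly p (x : R) : (Re_poly p).[x] = complex.Re p.[x%:C].
Proof.
rewrite horner_poly horner_coef Re_sum; apply: eq_bigr => i _.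
by rewrite -rmorphXn; case: p`_i => a b /=; rewrite mulr0 subr0.
Qed.

Lemma deriv_Re_poly p : (Re_poly p)^`() = Re_poly p^`().
Proof.
apply/polyP => i; rewrite coef_deriv !coef_Re_poly coef_deriv.
move: (p`_i.+1) => w; elim: i.+1 => [|k IHk]; first by rewrite !mulr0n.
by rewrite !mulrS IHk; case: w {IHk} => a b; case: (_ *+ k).
Qed.

Definition disk_regular (F : R[i] -> R[i]) :=
  disk_bounded (fun z : R * R => complex.Re (F (z.1 +i* z.2))) /\
  disk_bounded (fun z : R * R => complex.Im (F (z.1 +i* z.2))).

Lemma disk_boundedD (f g : R * R -> R) : disk_bounded f -> disk_bounded g ->
  disk_bounded (fun z => f z + g z).
Proof.
move=> [mf [M fM]] [mg [N gN]]; split; first exact: measurable_funD.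
exists (M + N) => z Dz; rewrite (le_trans (ler_normD _ _))// lerD//; [exact: fM|exact: gN].
Qed.

Lemma disk_boundedM (f g : R * R -> R) : disk_bounded f -> disk_bounded g ->
  disk_bounded (fun z => f z * g z).
Proof.
move=> [mf [M fM]] [mg [N gN]]; split; first exact: measurable_funM.
exists (M * N) => z Dz; rewrite normrM ler_pM//; [exact: fM|exact: gN].
Qed.

Lemma disk_bounded_cst (c : R) : disk_bounded (fun _ : R * R => c).
Proof. by split; [exact: measurable_cst|exists `|c|]. Qed.

Lemma disk_boundedN (f : R * R -> R) : disk_bounded f -> disk_bounded (fun z => - f z).
Proof.
move=> bf; have := disk_boundedM (disk_bounded_cst (-1)) bf.
by under eq_fun do rewrite mulN1r.
Qed.

Lemma disk_regularD F G : disk_regular F -> disk_regular G ->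
  disk_regular (fun z => F z + G z).
Proof.
move=> [F1 F2] [G1 G2]; split.
- have := disk_boundedD F1 G1; congr disk_bounded; apply/funext => z.
  by case: (F _) => a b; case: (G _).
- have := disk_boundedD F2 G2; congr disk_bounded; apply/funext => z.
  by case: (F _) => a b; case: (G _).
Qed.

Lemma disk_regularM F G : disk_regular F -> disk_regular G ->
  disk_regular (fun z => F z * G z).
Proof.
move=> [F1 F2] [G1 G2]; split.
- have := disk_boundedD (disk_boundedM F1 G1) (disk_boundedN (disk_boundedM F2 G2)).
  by congr disk_bounded; apply/funext => z; case: (F _) => a b; case: (G _).
- have := disk_boundedD (disk_boundedM F1 G2) (disk_boundedM F2 G1).
  by congr disk_bounded; apply/funext => z; case: (F _) => a b; case: (G _).
Qed.

Lemma disk_regular_cst c : disk_regular (fun _ => c).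
Proof. by split; exact: disk_bounded_cst. Qed.

Lemma disk_regularX F n : disk_regular F -> disk_regular (fun z => F z ^+ n).
Proof.
move=> rF; elim: n => [|n IHn].
  by under eq_fun do rewrite expr0; exact: disk_regular_cst.
by under eq_fun do rewrite exprS; exact: disk_regularM.
Qed.

Lemma disk_bounded_fst : disk_bounded (fun z : R * R => z.1).
Proof.
split; first exact: measurable_fst.
exists 1 => -[x y] /unit_diskE xy /=.
rewrite -(@expr_le1 _ 2)// real_normK ?num_real// (le_trans _ (ltW xy))//.
by rewrite lerDl sqr_ge0.
Qed.

Lemma disk_bounded_snd : disk_bounded (fun z : R * R => z.2).
Proof.
split; first exact: measurable_snd.
exists 1 => -[x y] /unit_diskE xy /=.
rewrite -(@expr_le1 _ 2)// real_normK ?num_real// (le_trans _ (ltW xy))//.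
by rewrite lerDr sqr_ge0.
Qed.

Lemma disk_regular_id : disk_regular id.
Proof. by split; [exact: disk_bounded_fst|exact: disk_bounded_snd]. Qed.

Lemma disk_regular_conj : disk_regular (@conjc R).
Proof.
by split; [exact: disk_bounded_fst|apply: disk_boundedN; exact: disk_bounded_snd].
Qed.

Lemma disk_integralD F G : disk_regular F -> disk_regular G ->
  disk_integral (fun z => F z + G z) = disk_integral F + disk_integral G.
Proof.
move=> [F1 F2] [G1 G2]; apply/eqP; rewrite eq_complex /=; apply/andP; split; apply/eqP.
- rewrite -RintegralD; first last.
  + exact: disk_bounded_integrable.
  + exact: disk_bounded_integrable.
  + exact: measurable_unit_disk.
  by congr (Rintegral _ _ _); apply/funext => z; case: (F _) => a b; case: (G _).
- rewrite -RintegralD; first last.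
  + exact: disk_bounded_integrable.
  + exact: disk_bounded_integrable.
  + exact: measurable_unit_disk.
  by congr (Rintegral _ _ _); apply/funext => z; case: (F _) => a b; case: (G _).
Qed.

Lemma disk_integralZ (c : R[i]) F : disk_regular F ->
  disk_integral (fun z => c * F z) = c * disk_integral F.
Proof.
case: c => a b [F1 F2].
have i1 := disk_bounded_integrable F1; have i2 := disk_bounded_integrable F2.
have mD := @measurable_unit_disk R.
have bZ (c : R) f : disk_bounded f -> disk_bounded (fun z : R * R => c * f z).
  by apply: disk_boundedM; exact: disk_bounded_cst.
apply/eqP; rewrite eq_complex /= -mulNr; apply/andP; split; apply/eqP.
- rewrite -!RintegralZl// -RintegralD//; [|exact/disk_bounded_integrable/bZ..].
  by congr (Rintegral _ _ _); apply/funext => z; case: (F _) => u v; rewrite /= mulNr.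
- rewrite -!RintegralZl// -RintegralD//; [|exact/disk_bounded_integrable/bZ..].
  by congr (Rintegral _ _ _); apply/funext => z; case: (F _).
Qed.

Lemma disk_integral_conj F : disk_regular F ->
  disk_integral (fun z => conjc (F z)) = conjc (disk_integral F).
Proof.
move=> [F1 F2]; apply/eqP; rewrite eq_complex /=; apply/andP; split; apply/eqP.
- by congr (Rintegral _ _ _); apply/funext => z; case: (F _).
- rewrite -mulN1r -RintegralZl; first last.
  + exact: disk_bounded_integrable.
  + exact: measurable_unit_disk.
  by congr (Rintegral _ _ _); apply/funext => z; case: (F _) => a b; rewrite mulN1r.
Qed.

Lemma disk_regular_sum I (r : seq I) (F : I -> R[i] -> R[i]) :
  (forall i, disk_regular (F i)) -> disk_regular (fun z => \sum_(i <- r) F i z).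
Proof.
move=> rF; elim: r => [|i r IHr].
  by under eq_fun do rewrite big_nil; exact: disk_regular_cst.
by under eq_fun do rewrite big_cons; exact: disk_regularD.
Qed.

Lemma disk_integral_sum I (r : seq I) (F : I -> R[i] -> R[i]) :
  (forall i, disk_regular (F i)) ->
  disk_integral (fun z => \sum_(i <- r) F i z) = \sum_(i <- r) disk_integral (F i).
Proof.
move=> rF; elim: r => [|i r IHr].
  under eq_fun do rewrite big_nil; rewrite big_nil -[RHS](mul0r (disk_integral (fun=> 1))).
  rewrite -disk_integralZ; last exact: disk_regular_cst.
  by congr disk_integral; apply/funext => z; rewrite mul0r.
under eq_fun do rewrite big_cons; rewrite big_cons -IHr disk_integralD//.
exact: disk_regular_sum.
Qed.

Lemma chord_integral_deriv0 (H : {poly R[i]}) (s : R) : 0 < s ->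
  H.[s%:C] = 0 -> H.[(- s)%:C] = 0 ->
  (\int[mu1]_(t in `](- s)%R, s[) (complex.Re H^`().[t%:C])%:E = 0)%E /\
  (\int[mu1]_(t in `](- s)%R, s[) (complex.Im H^`().[t%:C])%:E = 0)%E.
Proof.
move=> s0 Hs HNs; split.
  under eq_integral do rewrite -horner_Re_poly -deriv_Re_poly.
  by rewrite integral_deriv_poly// !horner_Re_poly Hs HNs subrr.
have Im_Re (w : R[i]) : complex.Im w = complex.Re ((- 'i%C) * w).
  by case: w => a b; simpc.
under eq_integral do
  rewrite Im_Re -hornerZ -derivZ -horner_Re_poly -deriv_Re_poly.
by rewrite integral_deriv_poly// !horner_Re_poly !hornerZ Hs HNs subrr.
Qed.

(** If [F] is the derivative in [x] of a function that vanishes on the unit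
    circle and is polynomial on each horizontal chord, its integral over every
    such chord is the difference of two values at boundary points, that is 0. *)
Lemma disk_integral_deriv_x (F : R[i] -> R[i]) (H : R -> {poly R[i]}) :
  disk_regular F ->
  (forall x y : R, F (x +i* y) = (H y)^`().[x%:C]) ->
  (forall x y : R, x ^+ 2 + y ^+ 2 = 1 -> (H y).[x%:C] = 0) ->
  disk_integral F = 0.
Proof.
move=> [F1 F2] FH H0.
have slice0 (y : R) : `|y| < 1 ->
    (\int[mu1]_(x in `](- half_chord y)%R, half_chord y[)
       (complex.Re (F (x +i* y)))%:E = 0)%E /\
    (\int[mu1]_(x in `](- half_chord y)%R, half_chord y[)
       (complex.Im (F (x +i* y)))%:E = 0)%E.
  move=> y1; under eq_integral do rewrite FH.
  under [X in _ /\ X = _]eq_integral do rewrite FH.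
  apply: chord_integral_deriv0; first exact: half_chord_gt0.
    by rewrite H0// sqr_half_chord// subrK.
  by rewrite H0// sqrrN sqr_half_chord// subrK.
apply/eqP; rewrite eq_complex /=; apply/andP; split; apply/eqP;
  rewrite /Rintegral Fubini_disk_yx// (eq_integral (cst 0%E)) ?integral0// => y;
  by rewrite inE /= in_itv /= -ltr_norml => /slice0[].
Qed.

Lemma disk_integral_deriv_y (F : R[i] -> R[i]) (H : R -> {poly R[i]}) :
  disk_regular F ->
  (forall x y : R, F (x +i* y) = (H x)^`().[y%:C]) ->
  (forall x y : R, x ^+ 2 + y ^+ 2 = 1 -> (H x).[y%:C] = 0) ->
  disk_integral F = 0.
Proof.
move=> [F1 F2] FH H0.
have slice0 (x : R) : `|x| < 1 ->
    (\int[mu1]_(y in `](- half_chord x)%R, half_chord x[)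
       (complex.Re (F (x +i* y)))%:E = 0)%E /\
    (\int[mu1]_(y in `](- half_chord x)%R, half_chord x[)
       (complex.Im (F (x +i* y)))%:E = 0)%E.
  move=> x1; under eq_integral do rewrite FH.
  under [X in _ /\ X = _]eq_integral do rewrite FH.
  apply: chord_integral_deriv0; first exact: half_chord_gt0.
    by rewrite H0// sqr_half_chord// addrC subrK.
  by rewrite H0// sqrrN sqr_half_chord// addrC subrK.
apply/eqP; rewrite eq_complex /=; apply/andP; split; apply/eqP;
  rewrite /Rintegral Fubini_disk_xy// (eq_integral (cst 0%E)) ?integral0// => x;
  by rewrite inE /= in_itv /= -ltr_norml => /slice0[].
Qed.

(** * The area of the unit disk *)

Lemma continuous_half_chord : continuous (@half_chord R).
Proof.
move=> x; apply: continuous_comp; last exact: sqrt_continuous.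
by apply: cvgB; [exact: cvg_cst|exact: exprn_continuous].
Qed.

Lemma is_derive_half_chord (x : R) : `|x| < 1 ->
  is_derive x 1 (@half_chord R) (- (x / half_chord x)).
Proof.
move=> x1; have s0 := half_chord_gt0 x1.
have g0 : 0 < 1 - x ^+ 2 by rewrite -sqrtr_gt0.
have dg : is_derive x 1 (fun x : R => 1 - x ^+ 2) (- (2 * x)).
  apply: is_derive_eq.
  by rewrite /GRing.scale /= ?expr1; ring.
have := @is_derive1_comp _ (@Num.sqrt R) (fun y : R => 1 - y ^+ 2)
  _ _ _ (is_derive1_sqrt g0) dg.
move/is_derive_eq; apply; rewrite /GRing.scale /= -/(half_chord x).
by field; rewrite gt_eqF.
Qed.

(** The usual primitive [x sqrt(1 - x^2) + arcsin x] of [2 sqrt(1 - x^2)].  The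
    half-angle form [2 arctan (x / (1 + sqrt(1 - x^2)))] of [arcsin x] is visibly
    continuous at the end points [-1] and [1] as well, as the fundamental theorem
    of calculus on the closed interval requires. *)
Definition disk_area_primitive (x : R) : R :=
  x * half_chord x + 2 * atan (x / (1 + half_chord x)).

Lemma half_chord_denom (x : R) : 1 + half_chord x != 0.
Proof. by rewrite gt_eqF// ltr_pwDl// sqrtr_ge0. Qed.

Lemma continuous_disk_area_primitive : continuous disk_area_primitive.
Proof.
move=> x; have cs := @continuous_half_chord x.
apply: cvgD; first by apply: cvgM => //; exact: cvg_id.
apply: cvgM; first exact: cvg_cst.
apply: (@continuous_comp _ _ _ (fun y : R => y / (1 + half_chord y)) (@atan R));
  last exact: continuous_atan.
apply: cvgM; first exact: cvg_id.
apply: cvgV; first exact: half_chord_denom.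
by apply: cvgD => //; exact: cvg_cst.
Qed.

Lemma is_derive_disk_area_primitive (x : R) : `|x| < 1 ->
  is_derive x 1 disk_area_primitive (2 * half_chord x).
Proof.
move=> x1; have s0 := half_chord_gt0 x1; have sE := sqr_half_chord x1.
have ds := is_derive_half_chord x1.
have s1 := half_chord_denom x.
set s := half_chord x in s0 sE ds s1 *.
have sn0 : s != 0 by rewrite gt_eqF.
have du : is_derive x 1 (fun y : R => y / (1 + half_chord y)) (s * (1 + s))^-1.
  have dd : is_derive x 1 (fun y : R => 1 + half_chord y) (- (x / s)).
    have := is_deriveD (is_derive_cst (1 : R) x 1) ds; rewrite add0r; exact: id.
  have dv : is_derive x 1 (fun y : R => (1 + half_chord y)^-1)
      (- (1 + s) ^- 2 *: - (x / s)) by exact: is_deriveV.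
  have := is_deriveM (is_derive_id x (1 : R)) dv; move/is_derive_eq; apply.
  rewrite /GRing.scale /= -/s.
  have x2 : x ^+ 2 = 1 - s ^+ 2 by rewrite sE; ring.
  transitivity ((x ^+ 2 + s * (1 + s)) / (s * (1 + s) ^+ 2)).
    by field; rewrite s1 sn0.
  by rewrite x2; field; rewrite s1 sn0.
have da := @is_derive1_comp _ (@atan R) (fun y : R => y / (1 + half_chord y))
  _ _ _ (is_derive1_atan (x / (1 + s))) du.
have := is_deriveD (is_deriveM (is_derive_id x (1 : R)) ds) (is_deriveZ 2 da).
move/is_derive_eq; apply; rewrite /GRing.scale /= -/s.
have x2 : x ^+ 2 = 1 - s ^+ 2 by rewrite sE; ring.
have -> : 1 + (x / (1 + s)) ^+ 2 = 2 / (1 + s).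
  by rewrite expr_div_n x2; field.
have -> : x * - (x / s) = - (1 - s ^+ 2) / s by rewrite -x2; field.
by field; rewrite s1 sn0.
Qed.

Lemma disk_area : \int[mu2]_(z in D) 1 = pi :> R.
Proof.
rewrite /Rintegral Fubini_disk_xy; last exact: disk_bounded_cst.
transitivity (fine (\int[mu1]_(x in `](-1)%R, 1%R[) (2 * half_chord x)%:E)%E).
  congr fine; apply: eq_integral => x.
  rewrite inE /= in_itv /= -ltr_norml => x1.
  have := integral_deriv_poly 'X (half_chord_gt0 x1).
  rewrite derivX !hornerX opprK => e.
  under eq_integral => y _ do rewrite -(hornerC 1 y).
  by rewrite e; congr (_%:E); ring.
have c2 : continuous (fun x : R => 2 * half_chord x).
  by move=> x; apply: cvgM; [exact: cvg_cst|exact: continuous_half_chord].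
rewrite -(integral_itv_bndoo true false); last first.
  apply/measurable_EFinP; apply: measurable_funTS.
  exact: continuous_measurable_fun.
rewrite (@continuous_FTC2 _ _ disk_area_primitive).
- rewrite /disk_area_primitive /half_chord sqrrN expr1n subrr sqrtr0 /=.
  by rewrite !mulr0 !addr0 !divr1 atanN atan1; field.
- by lra.
- exact: continuous_subspaceT.
- split.
  + move=> x; rewrite in_itv /= -ltr_norml => x1.
    by have [] := is_derive_disk_area_primitive x1.
  + by apply: cvg_at_right_filter; exact: continuous_disk_area_primitive.
  + by apply: cvg_at_left_filter; exact: continuous_disk_area_primitive.
- move=> x; rewrite in_itv /= -ltr_norml => x1.
  by rewrite derive1E; have [_ ->] := is_derive_disk_area_primitive x1.
Qed.

(** * Integrals of monomials and complex moments *)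

Lemma complex_split x y : x +i* y = x%:C + 'i%C * y%:C.
Proof. by rewrite [LHS]complexE. Qed.

Lemma conjc_split x y : conjc (x +i* y) = x%:C - 'i%C * y%:C.
Proof. by simpc. Qed.

Lemma disk_boundary_factor x y :
  1 - (y ^+ 2)%:C - x%:C ^+ 2 = 1 - (x +i* y) * conjc (x +i* y).
Proof.
rewrite complex_split conjc_split rmorphXn /=.
transitivity (1 - (x%:C ^+ 2 - 'i%C ^+ 2 * y%:C ^+ 2)); last by ring.
by rewrite sqr_i; ring.
Qed.

Definition disk_monomial p q (z : R[i]) : R[i] := z ^+ p * conjc z ^+ q.

Lemma disk_regular_monomial p q : disk_regular (disk_monomial p q).
Proof.
by apply: disk_regularM; apply: disk_regularX;
  [exact: disk_regular_id|exact: disk_regular_conj].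
Qed.

Lemma disk_regularN F : disk_regular F -> disk_regular (fun z : R[i] => - F z).
Proof.
move=> [F1 F2]; split.
- by have := disk_boundedN F1; congr disk_bounded; apply/funext => z; case: (F _).
- by have := disk_boundedN F2; congr disk_bounded; apply/funext => z; case: (F _).
Qed.

Section WirtingerDerivative.
Variables p q : nat.

(** The Wirtinger derivatives, in [z] and in [zbar], of
    [z^p zbar^q (1 - z zbar)]. *)
Let dz (z : R[i]) : R[i] :=
  p%:R * (disk_monomial p.-1 q z * (1 - z * conjc z)) - disk_monomial p q.+1 z.
Let dzbar (z : R[i]) : R[i] :=
  q%:R * (disk_monomial p q.-1 z * (1 - z * conjc z)) - disk_monomial p.+1 q z.

Let regular_weight : disk_regular (fun z : R[i] => 1 - z * conjc z).
Proof.
apply: disk_regularD; first exact: disk_regular_cst.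
by apply: disk_regularN; exact: disk_regular_monomial 1 1.
Qed.

Let regular_dz : disk_regular dz.
Proof.
apply: disk_regularD; last by apply: disk_regularN; exact: disk_regular_monomial.
apply: disk_regularM; first exact: disk_regular_cst.
by apply: disk_regularM => //; exact: disk_regular_monomial.
Qed.

Let regular_dzbar : disk_regular dzbar.
Proof.
apply: disk_regularD; last by apply: disk_regularN; exact: disk_regular_monomial.
apply: disk_regularM; first exact: disk_regular_cst.
by apply: disk_regularM => //; exact: disk_regular_monomial.
Qed.

Let integral_dx : disk_integral (fun z => dz z + dzbar z) = 0.
Proof.
(* z^p zbar^q (1 - z zbar) on the horizontal line of ordinate y *)
pose H y : {poly R[i]} := ('X + ('i%C * y%:C)%:P) ^+ p * ('X - ('i%C * y%:C)%:P) ^+ q *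
  ((1 - (y ^+ 2)%:C)%:P - 'X ^+ 2).
have HE x y : (H y).[x%:C] =
    disk_monomial p q (x +i* y) * (1 - (x +i* y) * conjc (x +i* y)).
  rewrite /H !(hornerM, hornerD, hornerN, horner_exp, hornerX, hornerC).
  by rewrite -complex_split -conjc_split disk_boundary_factor.
apply: (disk_integral_deriv_x (H := H)).
- exact: disk_regularD regular_dz regular_dzbar.
- move=> x y; rewrite /H !derivM !deriv_exp !derivB !derivD !derivC !derivX.
  rewrite derivXn subr0 addr0 sub0r !mul1r.
  rewrite !(hornerM, hornerD, hornerN, hornerMn, horner_exp, hornerX, hornerC).
  rewrite -complex_split -conjc_split disk_boundary_factor.
  have -> : x%:C ^+ 2.-1 + x%:C ^+ 2.-1 = x +i* y + conjc (x +i* y).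
    by rewrite expr1; simpc.
  rewrite /dz /dzbar /disk_monomial !exprS.
  by ring.
- move=> x y xy; rewrite HE.
  rewrite -disk_boundary_factor -rmorphXn -addrA -opprD -rmorphD [y ^+ 2 + _]addrC xy.
  by rewrite subrr mulr0.
Qed.

Let integral_dy : disk_integral (fun z => 'i%C * (dz z - dzbar z)) = 0.
Proof.
(* z^p zbar^q (1 - z zbar) on the vertical line of abscissa x *)
pose H x : {poly R[i]} := ((x%:C)%:P + 'i%C *: 'X) ^+ p * ((x%:C)%:P - 'i%C *: 'X) ^+ q *
  ((1 - (x ^+ 2)%:C)%:P - 'X ^+ 2).
have wE x y : 1 - (x ^+ 2)%:C - y%:C ^+ 2 = 1 - (x +i* y) * conjc (x +i* y).
  by rewrite -disk_boundary_factor !rmorphXn /= addrAC.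
have HE x y : (H x).[y%:C] =
    disk_monomial p q (x +i* y) * (1 - (x +i* y) * conjc (x +i* y)).
  rewrite /H !(hornerM, hornerD, hornerN, horner_exp, hornerZ, hornerX, hornerC).
  by rewrite -complex_split -conjc_split wE.
apply: (disk_integral_deriv_y (H := H)).
- apply: disk_regularM; first exact: disk_regular_cst.
  by apply: disk_regularD regular_dz _; exact: disk_regularN regular_dzbar.
- move=> x y; rewrite /H !derivM !deriv_exp !derivB !derivD !derivC !derivZ !derivX.
  rewrite derivXn add0r !sub0r.
  rewrite !(hornerM, hornerD, hornerN, hornerMn, horner_exp, hornerZ, hornerX, hornerC).
  rewrite -complex_split -conjc_split wE.
  have -> : y%:C ^+ 2.-1 + y%:C ^+ 2.-1 = - 'i%C * (x +i* y - conjc (x +i* y)).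
    by rewrite expr1; simpc.
  rewrite /dz /dzbar /disk_monomial !exprS.
  by ring.
- move=> x y xy; rewrite HE.
  rewrite -disk_boundary_factor -rmorphXn -addrA -opprD -rmorphD [y ^+ 2 + _]addrC xy.
  by rewrite subrr mulr0.
Qed.

(** The partial derivatives of [z^p zbar^q (1 - z zbar)] in [x] and [y] are
    [dz + dzbar] and [i (dz - dzbar)], and both integrate to 0; so does [dz],
    which is [p z^(p-1) zbar^q - (p+1) z^p zbar^(q+1)].  For [p = 0] the truncated
    exponent is harmless because of the factor [p]. *)
Lemma disk_monomial_rec :
  p.+1%:R * disk_integral (disk_monomial p q.+1) =
  p%:R * disk_integral (disk_monomial p.-1 q).
Proof.
have r1 := disk_regularD regular_dz regular_dzbar.
have r2 : disk_regular (fun z => 'i%C * (dz z - dzbar z)).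
  apply: disk_regularM; first exact: disk_regular_cst.
  by apply: disk_regularD regular_dz _; exact: disk_regularN regular_dzbar.
have := disk_integralZ (- 'i%C) r2; rewrite integral_dy mulr0 => e2.
have r3 : disk_regular (fun z => - 'i%C * ('i%C * (dz z - dzbar z))).
  by apply: disk_regularM; first exact: disk_regular_cst.
have := disk_integralD r1 r3; rewrite integral_dx e2 addr0.
have -> : (fun z => dz z + dzbar z + - 'i%C * ('i%C * (dz z - dzbar z))) =
    (fun z => 2 * (p%:R * disk_monomial p.-1 q z + (- p.+1%:R) * disk_monomial p q.+1 z)).
  apply/funext => z; have ii w : - 'i%C * ('i%C * w) = w :> R[i].
    by rewrite mulrA mulNr -expr2 sqr_i opprK mul1r.
  rewrite ii.
  transitivity (2 * dz z).
    by move: (dz z) (dzbar z) => u v; ring.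
  congr (2 * _); rewrite /dz /disk_monomial.
  case: p => [|p'] /=; first by rewrite mul0r; ring.
  by rewrite !exprS -[p'.+2%:R]natr1; ring.
rewrite disk_integralZ; last first.
  by apply: disk_regularD; apply: disk_regularM;
    [exact: disk_regular_cst|exact: disk_regular_monomial
    |exact: disk_regular_cst|exact: disk_regular_monomial].
rewrite disk_integralD; [|by apply: disk_regularM;
    [exact: disk_regular_cst|exact: disk_regular_monomial]..].
rewrite !disk_integralZ; [|exact: disk_regular_monomial..].
by move/eqP; rewrite mulf_eq0 pnatr_eq0 /= mulNr subr_eq0 => /eqP ->.
Qed.

End WirtingerDerivative.

(** Along [p = q] the recursion starts from the area of the disk; for [p < q] it
    descends to [p = 0], where its right-hand side is 0.  Complex conjugation
    handles [p > q]. *)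
Lemma disk_integral_monomial p q :
  disk_integral (disk_monomial p q) = if p == q then pi%:C / p.+1%:R else 0.
Proof.
have n0 n : n.+1%:R != 0 :> R[i] by rewrite pnatr_eq0.
have diag k : disk_integral (disk_monomial k k) = pi%:C / k.+1%:R.
  elim: k => [|k IHk].
    rewrite divr1 /disk_monomial; under eq_fun do rewrite !expr0 mulr1.
    apply/eqP; rewrite eq_complex /= disk_area eqxx /=; apply/eqP.
    by rewrite /Rintegral integral0.
  apply: (mulfI (n0 k.+1)); rewrite disk_monomial_rec /= IHk.
  by rewrite mulrCA divff// mulr1 mulrCA divff// mulr1.
have upper d k : disk_integral (disk_monomial k (k + d.+1)) = 0.
  elim: k => [|k IHk].
    by apply: (mulfI (n0 0%N)); rewrite disk_monomial_rec mul0r mulr0.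
  by apply: (mulfI (n0 k.+1)); rewrite disk_monomial_rec /= IHk !mulr0.
have [<-|] := eqVneq; first exact: diag.
rewrite neq_ltn => /orP[pq|qp].
  by rewrite -(subnKC pq) addSnnS upper.
have -> : disk_monomial p q = (fun z => conjc (disk_monomial q p z)).
  by apply/funext => z; rewrite /disk_monomial rmorphM !rmorphXn /= conjcK mulrC.
rewrite disk_integral_conj; last exact: disk_regular_monomial.
by rewrite -(subnKC qp) addSnnS upper conjc0.
Qed.

(** The expansion of the integrand [P^k P' * conj P'] into monomials, of which
    only the diagonal ones contribute. *)
Lemma momentE k (P : {poly R[i]}) n : (size P^`() <= n)%N ->
  moment k P = \sum_(i < n) (P ^+ k * P^`())`_i * conjc P^`()`_i / i.+1%:R.
Proof.
move=> sP; rewrite /moment; set Q := P ^+ k * P^`().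
have -> : (fun z => P.[z] ^+ k * `|P^`().[z]| ^+ 2) = (fun z =>
    \sum_(l < n) conjc P^`()`_l * \sum_(i < size Q) Q`_i * disk_monomial i l z).
  apply/funext => z; have -> : `|P^`().[z]| ^+ 2 = P^`().[z] * conjc P^`().[z].
    by rewrite -add_Re2_Im2; case: (P^`().[z]) => a b; simpc; rewrite [b * a]mulrC addNr.
  rewrite mulrA -horner_exp -hornerM -/Q (horner_coef_wide _ sP) rmorph_sum mulr_sumr.
  apply: eq_bigr => l _; rewrite horner_coef mulr_suml mulr_sumr.
  apply: eq_bigr => i _; rewrite /disk_monomial rmorphM rmorphXn /=; ring.
have rm (a : R[i]) i l : disk_regular (fun z => a * disk_monomial i l z).
  by apply: disk_regularM; [exact: disk_regular_cst|exact: disk_regular_monomial].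
rewrite disk_integral_sum; last first.
  move=> l; apply: disk_regularM; first exact: disk_regular_cst.
  by apply: disk_regular_sum => i; exact: rm.
have pi0 : (@pi R)%:C != 0 by rewrite (inj_eq (@complexI R)) gt_eqF// pi_gt0.
rewrite mulr_sumr; apply: eq_bigr => l _.
rewrite disk_integralZ; last by apply: disk_regular_sum => i; exact: rm.
rewrite disk_integral_sum; last by move=> i; exact: rm.
under eq_bigr => i _ do
  rewrite (disk_integralZ _ (disk_regular_monomial i l)) disk_integral_monomial.
have -> : \sum_(i < size Q) Q`_i * (if i == l :> nat then pi%:C / i.+1%:R else 0) =
    Q`_l * (pi%:C / l.+1%:R).
  case: (ltnP l (size Q)) => [lQ|Ql].
    rewrite (bigD1 (Ordinal lQ))//= eqxx big1 ?addr0// => i il.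
    by rewrite ifN ?mulr0//; apply: contra il => /eqP e; apply/eqP/val_inj.
  rewrite [Q`_l]nth_default// mul0r big1// => i _; rewrite ifN ?mulr0//.
  by rewrite neq_ltn (leq_trans (ltn_ord i) Ql).
by move: (pi%:C) pi0 => w w0; field; rewrite w0 nat1r pnatr_eq0.
Qed.

End DiskIntegral.

(** * The Jacobian as a determinant in the coefficients of the derivative *)

Section Jacobian.
Variable R : realType.

Lemma poly_of_coefs0 n (a : 'rV[R]_n) : (poly_of_coefs a)`_0 = 0.
Proof. by rewrite /poly_of_coefs coef_sum big1// => i _; rewrite coefZ coefXn mulr0. Qed.

Lemma size_poly_of_coefs n (a : 'rV[R]_n) : (size (poly_of_coefs a) <= n.+1)%N.
Proof.
apply: leq_trans (size_sum _ _ _) _; apply/bigmax_leqP => i _.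
by rewrite (leq_trans (size_scale_leq _ _))// size_polyXn ltnS.
Qed.

Lemma poly_of_coefs_line n (a : 'rV[R]_n) (nu : 'I_n) (h : R) :
  poly_of_coefs (h *: delta_mx 0 nu + a) = poly_of_coefs a + h *: 'X^(nu.+1).
Proof.
rewrite /poly_of_coefs.
under eq_bigr do rewrite !mxE scalerDl.
rewrite big_split /= addrC; congr (_ + _).
rewrite (bigD1 nu)//= !eqxx mulr1 big1 ?addr0// => i inu.
by rewrite (negbTE inu) mulr0 scale0r.
Qed.

Lemma moment_real n k (p : {poly R}) : (size p <= n.+1)%N ->
  moment k (complex_poly p) = (real_moment n k p)%:C.
Proof.
move=> sp; rewrite /complex_poly (@momentE _ _ _ n); last first.
  rewrite deriv_map size_map_poly; apply/leq_sizeP => j nj.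
  by rewrite coef_deriv nth_default ?mul0rn// (leq_trans sp).
rewrite deriv_map -rmorphXn -rmorphM rmorph_sum; apply: eq_bigr => i _.
rewrite !coef_map rmorphM /= -mulrA; congr (_ * _).
by rewrite oppr0 complexr0 coef_deriv rmorphMn /= -[_ *+ _]mulr_natr mulfK ?pnatr_eq0.
Qed.

Lemma partial_moment n (a : 'rV[R]_n) k (nu : 'I_n) :
  let P := complex_poly (poly_of_coefs a) in
  partial (fun b => moment k (complex_poly (poly_of_coefs b))) nu a =
  \sum_(m < n) (P ^+ k)`_m * sym_entry P^`() nu m.
Proof.
move=> P.
have mE (b : 'rV[R]_n) : moment k (complex_poly (poly_of_coefs b)) =
    (real_moment n k (poly_of_coefs b))%:C.
  by apply: moment_real; exact: size_poly_of_coefs.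
rewrite /partial; under eq_fun do rewrite mE /=.
rewrite [X in X +i* _](_ : _ =
   \sum_(m < n) (poly_of_coefs a ^+ k)`_m *
     sym_entry (poly_of_coefs a)^`() nu m); last first.
  apply: derive_along; have := is_derive_moment_sum nu k (size_poly_of_coefs a).
  by under [X in _ -> is_derive _ _ X _]eq_fun do rewrite poly_of_coefs_line.
rewrite [X in _ +i* X](_ : _ = 0); last first.
  by under eq_fun do rewrite mE /=; exact: derive_cst.
rewrite complexr0 rmorph_sum; apply: eq_bigr => m _.
rewrite rmorphM /P /complex_poly -rmorphXn coef_map deriv_map; congr (_ * _).
by rewrite /sym_entry !coef_map rmorphD; case: ifP; rewrite ?rmorph0.
Qed.

(** By [partial_moment] the Jacobian matrix is [T] times the transpose of
    [sym_toeplitz n P'], with [T] the coefficient matrix of the powers of [P];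
    since [P] is divisible by [X], the matrix [T] is upper triangular with
    diagonal [P_1^k]. *)
Lemma moment_jacobianE n (a : 'rV[R]_n) :
  let P := complex_poly (poly_of_coefs a) in
  moment_jacobian a = P`_1 ^+ 'C(n, 2) * \det (sym_toeplitz n P^`()).
Proof.
move=> P; pose T : 'M[R[i]]_n := \matrix_(k, m) (P ^+ k)`_m.
have P0 : P`_0 = 0 by rewrite coef_map poly_of_coefs0.
have PX : P = (P %/ 'X) * 'X.
  by rewrite divpK// -['X]subr0 -polyC0 dvdp_XsubCl /root horner_coef0 P0.
have Tlow k m : (P ^+ k)`_m = if (m < k)%N then 0 else ((P %/ 'X) ^+ k)`_(m - k).
  by rewrite {1}PX exprMn coefMXn.
have detT : \det T = P`_1 ^+ 'C(n, 2).
  rewrite -det_tr det_trig; last first.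
    by apply/is_trig_mxP => i j ij; rewrite !mxE Tlow ij.
  rewrite -triangular_sum big_mkord expr_sum; apply: eq_bigr => k _.
  rewrite !mxE Tlow ltnn subnn {2}PX coefMX /=.
  by rewrite -!horner_coef0 horner_exp.
rewrite /moment_jacobian -detT -[\det (sym_toeplitz _ _)]det_tr -det_mulmx.
congr (\det _); apply/matrixP => k nu; rewrite !mxE partial_moment.
by apply: eq_bigr => m _; rewrite !mxE.
Qed.

End Jacobian.

(** * The zeros of the derivative *)

(** Over an algebraically closed field the multiplicities determine the multiset
    of zeros, hence the polynomial up to its leading coefficient. *)
Lemma poly_of_zeros (K : closedFieldType) (p : {poly K}) (s : seq K) : p != 0 ->
  (forall z, count_mem z s = mup z p) ->
  p = lead_coef p *: \prod_(z <- s) ('X - z%:P).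
Proof.
move=> p0 sp; have [r pr] := closed_field_poly_normal p.
rewrite {1}pr; congr (_ *: _); apply: perm_big.
rewrite perm_sym; apply/allP => z _ /=; apply/eqP.
rewrite sp pr -mul_polyC mupMr ?mu_prod_XsubC//.
by rewrite rootC lead_coef_eq0.
Qed.

Lemma prod_leq_pairs (K : fieldType) n (z : 'I_n -> K) :
  \prod_(i < n) \prod_(j < n | (i <= j)%N) (z i * z j - 1) =
  \prod_(i < n) ((1 - z i) * (-1 - z i)) *
  \prod_(i < n) \prod_(j < n | (i < j)%N) (z i * z j - 1).
Proof.
rewrite -big_split /=; apply: eq_bigr => i _; rewrite (bigD1 i)//=.
congr (_ * _); first by ring.
by apply: eq_bigl => j; rewrite ltn_neqAle andbC eq_sym.
Qed.

Theorem theorem1 (R : realType) (n : nat) (hn : (2 <= n)%N) (a : 'rV[R]_n)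
    (ha1 : 0 < (poly_of_coefs a)`_1) (han : (poly_of_coefs a)`_n != 0)
    (zeta : (n.-1).-tuple R[i])
    (hzeta : forall z : R[i],
       count_mem z zeta = mup z (complex_poly (poly_of_coefs a))^`()) :
  let P := complex_poly (poly_of_coefs a) in
  let a1 := P`_1 in
  let an := P`_n in
  moment_jacobian a =
    2 * a1 ^+ (n * (n - 1))./2 * (n%:R * an) ^+ n *
    \prod_(i < n.-1) \prod_(j < n.-1 | (i <= j)%N)
      (tnth zeta i * tnth zeta j - 1)
  /\
  moment_jacobian a =
    2 * a1 ^+ (n * (n - 1))./2 * (n%:R * an) ^+ (n - 2) *
    P^`().[1] * P^`().[-1] *
    \prod_(i < n.-1) \prod_(j < n.-1 | (i < j)%N)
      (tnth zeta i * tnth zeta j - 1).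
Proof.
case: n hn a ha1 han zeta hzeta => [//|n] hn a ha1 han zeta /= hzeta.
set P := complex_poly _.
have Pn : P^`()`_n = n.+1%:R * P`_n.+1 by rewrite coef_deriv mulr_natl.
have Pn0 : P^`()`_n != 0.
  by rewrite Pn mulf_neq0 ?pnatr_eq0// coef_map fmorph_eq0.
have sP : size P^`() = n.+1.
  apply/eqP; rewrite eqn_leq andbC ltnNge; apply/andP; split.
    by apply: contra Pn0 => sn; rewrite nth_default.
  apply/leq_sizeP => j nj.
  by rewrite coef_deriv coef_map nth_default ?mul0rn// (leq_trans (size_poly_of_coefs a)).
have P'0 : P^`() != 0 by rewrite -size_poly_gt0 sP.
have PE : P^`() = (n.+1%:R * P`_n.+1) *: \prod_(i < n) ('X - (tnth zeta i)%:P).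
  rewrite {1}(poly_of_zeros P'0 hzeta) lead_coefE sP Pn.
  by rewrite (big_tuple _ _ zeta).
(* P'(0) = a_1 is not 0, so 0 is not among the zeros of P' *)
have zeta0 i : tnth zeta i != 0.
  apply: contraTneq (mem_tnth i zeta) => ->.
  rewrite -has_pred1 has_count hzeta mupNroot//.
  by rewrite /root horner_coef0 coef_deriv coef_map fmorph_eq0 gt_eqF.
have J : moment_jacobian a = 2 * P`_1 ^+ (n.+1 * (n.+1 - 1))./2 *
    (n.+1%:R * P`_n.+1) ^+ n.+1 * \prod_(i < n) \prod_(j < n | (i <= j)%N)
      (tnth zeta i * tnth zeta j - 1).
  rewrite moment_jacobianE -/P PE det_sym_toeplitz// bin2 subn1 /=.
  by rewrite !mulrA [_ * 2]mulrC.
split; first exact: J.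
rewrite J prod_leq_pairs big_split /= PE !hornerZ !horner_prod.
have evalE (x : R[i]) : \prod_(i < n) ('X - (tnth zeta i)%:P).[x] =
    \prod_(i < n) (x - tnth zeta i).
  by apply: eq_bigr => i _; rewrite hornerXsubC.
rewrite !evalE -[X in _ * _ ^+ X * _ = _](subnK hn) exprD expr2.
by ring.
Qed.
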